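(* Let $I=(v_1,v_2,D)$ be an HN ideal of $A$. Suppose that $x_1,x_2,x_3$ is a regular sequence and that $\operatorname{grade}(v)=2$. Then $I$ is an almost complete intersection.
   Context: $A$ is a commutative Noetherian ring with identity and $x_1,x_2,x_3\in A$ generate a proper ideal of height $3$. $a=(a_1,a_2,a_3)$ and $b=(b_1,b_2,b_3)$ are triples of positive integers, and $c=a+b=(c_1,c_2,c_3)$. Put $v_1=x_1^{c_1}-x_2^{b_2}x_3^{a_3}$, $v_2=x_2^{c_2}-x_1^{a_1}x_3^{b_3}$, $D=x_3^{c_3}-x_1^{b_1}x_2^{a_2}$, and $(v)=(v_1,v_2)$. The ideal $I=(v_1,v_2,D)$ is called an HN (Herzog-Northcott) ideal. The grade of an ideal is the maximal length of a regular sequence on $A$ contained in it. An ideal $I$ is an almost complete intersection if its minimal number of generators equals $\operatorname{height}(I)+1$ and, for every prime $\mathfrak{p}$ minimal over $I$, the localization $IA_{\mathfrak{p}}$ is a complete intersection, i.e. it can be generated by $\operatorname{height}(IA_{\mathfrak{p}})$ elements. *)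

(* Defs.v *)
From HB Require Import structures.
From mathcomp Require Import all_boot all_algebra.
From mathcomp Require Import boolp.

Set Implicit Arguments.
Unset Strict Implicit.
Unset Printing Implicit Defensive.

Import GRing.Theory.
Local Open Scope ring_scope.
Local Open Scope quotient_scope.

(* The library structure [idealr] describes proper ideals only; arbitrary     *)
(* ideals are predicates satisfying [is_ideal].  Prime ideals (which are      *)
(* proper) are the library's [prime_idealr].                                  *)
Definition is_ideal (A : comNzRingType) (I : {pred A}) : Prop :=
  0 \in I /\ forall r : A, {in I &, forall u v, r * u + v \in I}.

Definition ideal_gen (A : comNzRingType) (s : seq A) : {pred A} :=
  [pred y | `[< exists r : 'I_(size s) -> A,
                  y = \sum_(i < size s) r i * s`_i >]].

Definition noetherian (A : comNzRingType) : Prop :=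
  forall I : {pred A}, is_ideal I -> exists s : seq A, I =i ideal_gen s.

(* The ideal of B generated by the image of I under f. *)
Definition ideal_ext (A B : comNzRingType) (f : A -> B) (I : {pred A}) :
    {pred B} :=
  [pred y | `[< exists2 s : seq A, {subset s <= I}
                                 & y \in ideal_gen (map f s) >]].

Section Height.
Variable A : comNzRingType.
Implicit Types (P Q : prime_idealr A) (I : {pred A}).

(* There is a chain of n + 1 primes Q_0 < ... < Q_n = P. *)
Definition prime_chain P (n : nat) : Prop :=
  exists Q : nat -> prime_idealr A,
    Q n =i P /\
    forall i, (i < n)%N ->
      {subset Q i <= Q i.+1} /\ ~ {subset Q i.+1 <= Q i}.

Definition prime_height P (n : nat) : Prop :=
  prime_chain P n /\ forall m, prime_chain P m -> (m <= n)%N.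

(* height I = n, as the minimum of the heights of the primes containing I.    *)
(* The second clause says that every such prime has height at least n; it     *)
(* also makes sense for primes of infinite height.  The unit ideal has no     *)
(* (finite) height.                                                           *)
Definition height I (n : nat) : Prop :=
  (exists P, {subset I <= P} /\ prime_height P n) /\
  (forall P, {subset I <= P} -> prime_chain P n).

Definition minimal_prime I P : Prop :=
  {subset I <= P} /\
  forall Q, {subset I <= Q} -> {subset Q <= P} -> {subset P <= Q}.

End Height.

Section Grade.
Variable A : comNzRingType.
Implicit Types (s : seq A) (I : {pred A}).

Definition regular_sequence s : Prop :=
  1 \notin ideal_gen s /\
  forall i, (i < size s)%N -> forall y : A,
    s`_i * y \in ideal_gen (take i s) -> y \in ideal_gen (take i s).

Definition grade I (n : nat) : Prop :=
  (exists s, [/\ size s = n, {subset s <= I} & regular_sequence s]) /\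
  (forall s, {subset s <= I} -> regular_sequence s -> (size s <= n)%N).

Definition generated_by I (n : nat) : Prop :=
  exists s, size s = n /\ I =i ideal_gen s.

Definition min_generators I (n : nat) : Prop :=
  generated_by I n /\ forall m, generated_by I m -> (n <= m)%N.

Definition complete_intersection I : Prop :=
  exists2 h, height I h & generated_by I h.

End Grade.

Module Localization.
Section Localization.
Variables (A : comNzRingType) (P : prime_idealr A).

Lemma one_notin : 1 \notin (P : {pred A}).
Proof. by rewrite idealr1. Qed.

Lemma mul_notin (s t : A) : s \notin P -> t \notin P -> s * t \notin P.
Proof. by rewrite prime_idealrM negb_or => -> ->. Qed.

Definition pre_frac := {x : A * A | x.2 \notin P}.
HB.instance Definition _ := Choice.on pre_frac.
Implicit Types x y z : pre_frac.

Definition num x : A := (val x).1.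
Definition den x : A := (val x).2.
Definition mk (r s : A) (sP : s \notin P) : pre_frac := exist _ (r, s) sP.

Lemma denP x : den x \notin P. Proof. exact: (valP x). Qed.

Definition equiv x y : bool :=
  `[< exists2 u : A, u \notin P & u * (num x * den y) = u * (num y * den x) >].

Lemma equiv_refl : reflexive equiv.
Proof. by move=> x; apply/asboolP; exists 1 => //; exact: one_notin. Qed.

Lemma equiv_sym : symmetric equiv.
Proof.
by move=> x y; apply/asboolP/asboolP => -[u uP e]; exists u.
Qed.

Lemma equiv_trans : transitive equiv.
Proof.
move=> y x z /asboolP[u uP e1] /asboolP[w wP e2]; apply/asboolP.
exists (u * w * den y); first by rewrite !mul_notin ?denP.
transitivity (w * den z * (u * (num x * den y))).
  by rewrite (AC (3*2) (2*5*(1*(4*3)))).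
rewrite e1; transitivity (u * den x * (w * (num y * den z))).
  by rewrite (AC (2*(1*2)) (3*5*(1*(4*2)))).
by rewrite e2 (AC (2*(1*2)) ((1*3*5)*(4*2))).
Qed.

Canonical equiv_equiv := EquivRel equiv equiv_refl equiv_sym equiv_trans.

Definition type := {eq_quot equiv}.
HB.instance Definition _ : EqQuotient _ equiv type := EqQuotient.on type.
HB.instance Definition _ := Choice.on type.

Definition frac (r s : A) (sP : s \notin P) : type := \pi_type (mk r sP).

Lemma frac_eq r s r' s' (sP : s \notin P) (sP' : s' \notin P) :
  frac r sP = frac r' sP' <->
  exists2 u : A, u \notin P & u * (r * s') = u * (r' * s).
Proof.
split=> [/eqmodP/asboolP //|h]; apply/eqmodP; exact/asboolP.
Qed.

Lemma frac_surj (z : type) :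
  exists r s, exists sP : s \notin P, z = frac r sP.
Proof.
elim/quotW: z => x; exists (num x), (den x), (denP x).
by congr (\pi_type _); apply: val_inj; rewrite /= -surjective_pairing.
Qed.

Definition add_pre x y : pre_frac :=
  mk (num x * den y + num y * den x) (mul_notin (denP x) (denP y)).
Definition opp_pre x : pre_frac := mk (- num x) (denP x).
Definition mul_pre x y : pre_frac :=
  mk (num x * num y) (mul_notin (denP x) (denP y)).

Definition add := lift_op2 type add_pre.
Definition opp := lift_op1 type opp_pre.
Definition mul := lift_op2 type mul_pre.

Lemma equiv_repr x :
  exists2 u : A, u \notin P &
    u * (num x * den (repr (\pi_type x))) = u * (num (repr (\pi_type x)) * den x).
Proof.
have /eqmodP : x = repr (\pi_type x) %[mod type] by rewrite reprK.
by move/asboolP.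
Qed.

Lemma addE r s r' s' (sP : s \notin P) (sP' : s' \notin P) :
  add (frac r sP) (frac r' sP') = frac (r * s' + r' * s) (mul_notin sP sP').
Proof.
rewrite /frac; unlock add; apply/eqmodP/asboolP.
have [u uP /= e] := equiv_repr (mk r sP).
have [w wP /= e'] := equiv_repr (mk r' sP').
set x := repr _ in e *; set y := repr _ in e' *.
rewrite /num /den /= -/(num _) -/(den _) -/(num _) -/(den _) in e e' *.
exists (u * w); first exact: mul_notin.
rewrite !mulrDl !mulrDr; congr (_ + _).
  transitivity (w * den y * s' * (u * (num x * s))).
    by rewrite (AC (2*(2*2)) (2*4*6*(1*(3*5)))).
  by rewrite -e (AC (3*(1*2)) ((4*1)*((5*3)*(6*2)))).
transitivity (u * den x * s * (w * (num y * s'))).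
  by rewrite (AC (2*(2*2)) (1*4*5*(2*(3*6)))).
by rewrite -e' (AC (3*(1*2)) ((1*4)*((5*3)*(2*6)))).
Qed.

Lemma oppE r s (sP : s \notin P) : opp (frac r sP) = frac (- r) sP.
Proof.
rewrite /frac; unlock opp; apply/eqmodP/asboolP.
have [u uP /= e] := equiv_repr (mk r sP); exists u => //.
by rewrite /opp_pre /num /den /= !mulNr !mulrN; congr (- _); rewrite -[LHS]e.
Qed.

Lemma mulE r s r' s' (sP : s \notin P) (sP' : s' \notin P) :
  mul (frac r sP) (frac r' sP') = frac (r * r') (mul_notin sP sP').
Proof.
rewrite /frac; unlock mul; apply/eqmodP/asboolP.
have [u uP /= e] := equiv_repr (mk r sP).
have [w wP /= e'] := equiv_repr (mk r' sP').
set x := repr _ in e *; set y := repr _ in e' *.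
rewrite /num /den /= -/(num _) -/(den _) -/(num _) -/(den _) in e e' *.
exists (u * w); first exact: mul_notin.
transitivity ((u * (num x * s)) * (w * (num y * s'))).
  by rewrite (AC (2*(2*2)) ((1*(3*5))*(2*(4*6)))).
by rewrite -e -e' (AC ((1*2)*(1*2)) ((1*4)*((2*5)*(3*6)))).
Qed.

Lemma frac_ext r s r' s' (sP : s \notin P) (sP' : s' \notin P) :
  r * s' = r' * s -> frac r sP = frac r' sP'.
Proof. by move=> e; apply/frac_eq; exists 1; rewrite ?e ?one_notin. Qed.

Definition of_ring (r : A) : type := frac r one_notin.

Lemma addA : associative add.
Proof.
move=> z1 z2 z3; have [r1 [s1 [P1 ->]]] := frac_surj z1.
have [r2 [s2 [P2 ->]]] := frac_surj z2.
have [r3 [s3 [P3 ->]]] := frac_surj z3.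
rewrite !addE; apply: frac_ext; rewrite !mulrA; congr (_ * _ * _ * _).
by rewrite !mulrDl addrA [r2 * s1 * s3]mulrAC [r3 * s1 * s2]mulrAC
  [r3 * s2 * s1]mulrAC.
Qed.

Lemma addC : commutative add.
Proof.
move=> z1 z2; have [r1 [s1 [P1 ->]]] := frac_surj z1.
have [r2 [s2 [P2 ->]]] := frac_surj z2.
by rewrite !addE; apply: frac_ext; rewrite addrC [s1 * s2]mulrC.
Qed.

Lemma add0 : left_id (of_ring 0) add.
Proof.
move=> z; have [r [s [sP ->]]] := frac_surj z.
by rewrite addE; apply: frac_ext; rewrite mul0r add0r mulr1 mul1r.
Qed.

Lemma addN : left_inverse (of_ring 0) opp add.
Proof.
move=> z; have [r [s [sP ->]]] := frac_surj z.
by rewrite oppE addE; apply: frac_ext; rewrite mulNr addNr !mul0r.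
Qed.

HB.instance Definition _ := GRing.isZmodule.Build type addA addC add0 addN.

Lemma mulA : associative mul.
Proof.
move=> z1 z2 z3; have [r1 [s1 [P1 ->]]] := frac_surj z1.
have [r2 [s2 [P2 ->]]] := frac_surj z2.
have [r3 [s3 [P3 ->]]] := frac_surj z3.
by rewrite !mulE; apply: frac_ext; rewrite !mulrA.
Qed.

Lemma mulC : commutative mul.
Proof.
move=> z1 z2; have [r1 [s1 [P1 ->]]] := frac_surj z1.
have [r2 [s2 [P2 ->]]] := frac_surj z2.
by rewrite !mulE; apply: frac_ext; rewrite [r1 * _]mulrC [s1 * _]mulrC.
Qed.

Lemma mul1 : left_id (of_ring 1) mul.
Proof.
move=> z; have [r [s [sP ->]]] := frac_surj z.
by rewrite mulE; apply: frac_ext; rewrite !mul1r.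
Qed.

Lemma mulDl : left_distributive mul add.
Proof.
move=> z1 z2 z3; have [r1 [s1 [P1 ->]]] := frac_surj z1.
have [r2 [s2 [P2 ->]]] := frac_surj z2.
have [r3 [s3 [P3 ->]]] := frac_surj z3.
rewrite addE !mulE addE; apply: frac_ext; rewrite !mulrDl; congr (_ + _);
  by rewrite (AC (3*(2*2)) (1*3*(2*5)*(4*6*7))).
Qed.

Lemma one_neq0 : of_ring 1 != of_ring 0.
Proof.
apply/eqP => /frac_eq[u uP]; rewrite !mulr1 mulr0 => u0.
by move: uP; rewrite u0 idealr0.
Qed.

HB.instance Definition _ :=
  GRing.Zmodule_isComNzRing.Build type mulA mulC mul1 mulDl one_neq0.

End Localization.
End Localization.
HB.export Localization.

(* A_P, the localization at the prime P, and the canonical map A -> A_P. *)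
Notation localization P := (@Localization.type _ P).
Definition loc_map (A : comNzRingType) (P : prime_idealr A) :
  A -> localization P := @Localization.of_ring A P.

Section LocalizationTheory.
Variables (A : comNzRingType) (P : prime_idealr A).
Local Notation loc := (@loc_map A P).

Lemma loc_map_is_zmod_morphism : zmod_morphism loc.
Proof.
move=> r s; rewrite /loc_map.
rewrite -[RHS]/(Localization.add _ (Localization.opp _)).
rewrite Localization.oppE Localization.addE.
by apply: Localization.frac_ext; rewrite !mulr1.
Qed.

Lemma loc_map_is_monoid_morphism : monoid_morphism loc.
Proof.
split=> // r s; rewrite -[RHS]/(Localization.mul _ _) Localization.mulE.
by apply: Localization.frac_ext; rewrite !mulr1.
Qed.

HB.instance Definition _ := GRing.isZmodMorphism.Build A (localization P)
  loc loc_map_is_zmod_morphism.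
HB.instance Definition _ := GRing.isMonoidMorphism.Build A (localization P)
  loc loc_map_is_monoid_morphism.

(* The three lemmas below characterize A_P up to unique isomorphism. *)
Lemma loc_map_inv (s : A) : s \notin P -> exists z, loc s * z = 1.
Proof.
move=> sP; exists (Localization.frac 1 sP).
rewrite -[LHS]/(Localization.mul _ _) Localization.mulE.
by apply: Localization.frac_ext; rewrite !mulr1 !mul1r.
Qed.

Lemma loc_map_surj (z : localization P) :
  exists r s, s \notin P /\ z * loc s = loc r.
Proof.
have [r [s [sP ->]]] := Localization.frac_surj z; exists r, s; split=> //.
rewrite -[LHS]/(Localization.mul _ _) Localization.mulE.
by apply: Localization.frac_ext; rewrite !mulr1.
Qed.

Lemma loc_map_eq0 (r : A) :
  loc r = 0 <-> exists2 u, u \notin P & u * r = 0.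
Proof.
rewrite -[0]/(Localization.of_ring P 0) /loc_map.
split=> [/Localization.frac_eq|] [u uP e].
  by exists u => //; rewrite !mulr1 mulr0 in e.
by apply/Localization.frac_eq; exists u; rewrite // !mulr1 mulr0.
Qed.

End LocalizationTheory.

Definition almost_complete_intersection (A : comNzRingType) (I : {pred A}) :
    Prop :=
  (exists2 h, height I h & min_generators I h.+1) /\
  (forall P : prime_idealr A, minimal_prime I P ->
     complete_intersection (ideal_ext (@loc_map A P) I)).

(* Main.v *)
(* Put I = (v1, v2, D), the ideal of 2x2 minors of the matrix with rows       *)
(* (x1^a1, x2^a2, x3^a3) and (x2^b2, x3^b3, x1^b1).  Setting x1 = 0 turns the  *)
(* minors into monomials in the regular sequence x2, x3, whose syzygies are    *)
(* known; hence modulo x1 every syzygy of v1, v2, D is a combination of the    *)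
(* two rows.  Two consequences follow.  All syzygies have entries in the       *)
(* proper ideal (x1, x2, x3), so I cannot be generated by two elements; and x1 *)
(* is a nonzerodivisor modulo I, so it avoids every prime P minimal over I.    *)
(* Since x1^a1 D lies in (v1, v2), such a P is minimal over (v1, v2) and I A_P *)
(* is generated by v1 and v2.  Krull's height theorem for two elements bounds  *)
(* the height of P by 2, and a regular sequence of length 2 in (v1, v2) shows  *)
(* that every prime containing I has height at least 2.                        *)
From HB Require Import structures.
Require Import Defs.
From mathcomp Require Import all_boot all_algebra.
From mathcomp Require Import boolp classical_sets.
From mathcomp Require Import ring.
Import GRing.Theory.
Local Open Scope ring_scope.

Set Implicit Arguments.
Unset Strict Implicit.
Unset Printing Implicit Defensive.

Local Open Scope classical_set_scope.

(** The source of everything is [hn_syzygy]: modulo [x1], the syzygies of v1, v2, D are spanned by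
    the two rows of the matrix. Hence all syzygies have entries in (x1, x2, x3), and
    [min_generators3] excludes two generators by a rank argument. Hence also [x1] is regular modulo
    I and avoids each minimal prime P, so D is redundant in A_P ([loc_ideal_gen3]) and P is minimal
    over (v1, v2). The height of P is two: [krull_height2] bounds it above,
    [regular_sequence2_chain] below, and [loc_prime_chain] carries it to A_P. *)

(** * Ideals as sets, and generated ideals *)

Definition ideal_set (A : comNzRingType) (J : set A) : Prop :=
  J 0 /\ forall r u v, J u -> J v -> J (r * u + v).

Lemma ideal_setD (A : comNzRingType) (J : set A) (u v : A) :
  ideal_set J -> J u -> J v -> J (u + v).
Proof. by move=> [_ h] Ju Jv; rewrite -[u]mul1r; exact: h. Qed.

Lemma ideal_setM (A : comNzRingType) (J : set A) (r u : A) :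
  ideal_set J -> J u -> J (r * u).
Proof. by move=> [J0 h] Ju; rewrite -[_ * _]addr0; exact: h. Qed.

Lemma ideal_setB (A : comNzRingType) (J : set A) (u v : A) :
  ideal_set J -> J u -> J v -> J (u - v).
Proof.
by move=> idJ Ju Jv; rewrite -mulN1r; apply: ideal_setD => //; exact: ideal_setM.
Qed.

Lemma is_ideal_set (A : comNzRingType) (I : {pred A}) :
  is_ideal I <-> ideal_set [set` I].
Proof.
by split=> -[I0 h]; split=> // r u v uI vI; exact: h.
Qed.

Lemma prime_ideal_set (A : comNzRingType) (P : prime_idealr A) :
  ideal_set [set` P].
Proof.
split=> [|r u v uP vP]; first exact: idealr0.
by apply: rpredD => //; exact: idealMr.
Qed.

Lemma prime_idealX (A : comNzRingType) (P : prime_idealr A) (y : A) (n : nat) :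
  y ^+ n \in P -> y \in P.
Proof.
elim: n => [|n IHn]; first by rewrite expr0 idealr1.
by rewrite exprS prime_idealrM => /orP[].
Qed.

Lemma prime_of_set (A : comNzRingType) (J : set A) :
  ideal_set J -> ~ J 1 -> (forall u v, J (u * v) -> J u \/ J v) ->
  exists P : prime_idealr A, forall y, (y \in P) <-> J y.
Proof.
move=> idJ J1 Jprime.
pose S : A -> bool := fun y => `[< J y >].
have ideal_S : idealr_closed S.
  split; first exact/asboolP/idJ.1.
    by apply/negP => /asboolP.
  by move=> r u v /asboolP Ju /asboolP Jv; apply/asboolP; exact: idJ.2.
have prime_S : prime_idealr_closed S.
  by move=> u v /asboolP/Jprime[] h; apply/orP; [left|right]; exact/asboolP.
pose m1 := isIdealr.Build A S ideal_S.
pose m2 := isPrimeIdealrClosed.Build A S prime_S.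
pose P : prime_idealr A := HB.pack S m1 m2.
by exists P => y; split=> /asboolP.
Qed.

Lemma ideal_gen_nil (A : comNzRingType) (y : A) :
  y \in ideal_gen [::] <-> y = 0.
Proof.
split=> [/asboolP[r ->]|->]; first by rewrite big_ord0.
by apply/asboolP; exists (fun=> 0); rewrite big_ord0.
Qed.

Lemma ideal_gen_cons (A : comNzRingType) (a : A) (s : seq A) (y : A) :
  y \in ideal_gen (a :: s) <->
  exists r z, z \in ideal_gen s /\ y = r * a + z.
Proof.
split=> [/asboolP[r ->]|[r [z [/asboolP[q ->] ->]]]].
  exists (r ord0), (\sum_(i < size s) r (lift ord0 i) * s`_i); split.
    by apply/asboolP; exists (fun i => r (lift ord0 i)).
  by rewrite big_ord_recl.
apply/asboolP; exists (fun i => if unlift ord0 i is Some j then q j else r).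
rewrite big_ord_recl unlift_none; congr (_ + _).
by apply: eq_bigr => i _; rewrite liftK.
Qed.

Lemma ideal_gen1 (A : comNzRingType) (a y : A) :
  y \in ideal_gen [:: a] <-> exists r, y = r * a.
Proof.
split=> [/ideal_gen_cons[r [z [/ideal_gen_nil-> ->]]]|[r ->]].
  by exists r; rewrite addr0.
by apply/ideal_gen_cons; exists r, 0; rewrite addr0; split=> //; apply/ideal_gen_nil.
Qed.

Lemma ideal_gen2 (A : comNzRingType) (a b y : A) :
  y \in ideal_gen [:: a; b] <-> exists r s, y = r * a + s * b.
Proof.
split=> [/ideal_gen_cons[r [z [/ideal_gen1[s ->] ->]]]|[r [s ->]]].
  by exists r, s.
by apply/ideal_gen_cons; exists r, (s * b); split=> //; apply/ideal_gen1; exists s.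
Qed.

Lemma ideal_gen3 (A : comNzRingType) (a b c y : A) :
  y \in ideal_gen [:: a; b; c] <-> exists r s t, y = r * a + s * b + t * c.
Proof.
split=> [/ideal_gen_cons[r [z [/ideal_gen2[s [t ->]] ->]]]|[r [s [t ->]]]].
  by exists r, s, t; rewrite addrA.
apply/ideal_gen_cons; exists r, (s * b + t * c); rewrite addrA; split=> //.
by apply/ideal_gen2; exists s, t.
Qed.

Lemma ideal_gen_ideal (A : comNzRingType) (s : seq A) :
  is_ideal (ideal_gen s).
Proof.
split.
  by apply/asboolP; exists (fun=> 0); rewrite big1 // => i _; rewrite mul0r.
move=> r u v /asboolP[p ->] /asboolP[q ->]; apply/asboolP.
exists (fun i => r * p i + q i); rewrite mulr_sumr -big_split.
by apply: eq_bigr => i _; rewrite /= mulrDl mulrA.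
Qed.

Lemma ideal_gen_set (A : comNzRingType) (s : seq A) :
  ideal_set [set` ideal_gen s].
Proof. exact/is_ideal_set/ideal_gen_ideal. Qed.

Lemma ideal_gen_mem (A : comNzRingType) (s : seq A) : {subset s <= ideal_gen s}.
Proof.
elim: s => // a s IHs y; rewrite inE => /orP[/eqP->|ys].
  apply/ideal_gen_cons; exists 1, 0; rewrite mul1r addr0; split=> //.
  by have [] := ideal_gen_ideal s.
by apply/ideal_gen_cons; exists 0, y; rewrite mul0r add0r; split=> //; exact: IHs.
Qed.

Lemma ideal_gen_min (A : comNzRingType) (J : set A) (s : seq A) :
  ideal_set J -> {in s, forall y, J y} -> forall y, y \in ideal_gen s -> J y.
Proof.
move=> idJ; elim: s => [_ y /ideal_gen_nil-> |a s IHs Js y]; first exact: idJ.1.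
move=> /ideal_gen_cons[r [z [zs ->]]]; apply: idJ.2.
  by apply: Js; rewrite mem_head.
by apply: IHs => // w ws; apply: Js; rewrite inE ws orbT.
Qed.

(** * Noetherian rings and the existence of primes *)

Lemma noetherian_fg (A : comNzRingType) (J : set A) :
  noetherian A -> ideal_set J ->
  exists s : seq A, forall y, J y <-> y \in ideal_gen s.
Proof.
move=> noethA idJ; pose I : {pred A} := [pred y | `[< J y >]].
have /noethA[s Is] : is_ideal I.
  split; first exact/asboolP/idJ.1.
  by move=> r u v /asboolP Ju /asboolP Jv; apply/asboolP; exact: idJ.2.
by exists s => y; rewrite -Is; split=> /asboolP.
Qed.

(** Without a maximal member, choice yields a strictly increasing chain in [F]; but the finitely
    many generators of its union already lie in one term. *)
Lemma noetherian_max (A : comNzRingType) (F : set (set A)) :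
  noetherian A -> F `<=` @ideal_set A -> F !=set0 ->
  exists2 J, F J & forall K, F K -> J `<=` K -> K `<=` J.
Proof.
move=> noethA Fid [J0 FJ0]; apply: contrapT => nomax.
have /choice[f fP] (J : {J | F J}) :
    exists K : {J | F J}, sval J `<=` sval K /\ ~ sval K `<=` sval J.
  apply: contrapT => noK; apply: nomax; exists (sval J); first exact: svalP.
  move=> K FK JK; apply: contrapT => KJ; apply: noK.
  by exists (exist _ K FK).
pose J n : set A := sval (iter n f (exist _ J0 FJ0)).
have Jid n : ideal_set (J n) by apply: Fid; exact: svalP.
have Jmono m n : (m <= n)%N -> J m `<=` J n.
  move=> /subnK<-; elim: (n - m)%N => // k IHk y Jy.
  by rewrite addSn; apply: (fP _).1; exact: IHk.
pose U : set A := [set y | exists n, J n y].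
have Uid : ideal_set U.
  split; first by exists 0%N; exact: (Jid _).1.
  move=> r u v [m Ju] [n Jv]; exists (maxn m n); apply: (Jid _).2.
    by apply: Jmono Ju; exact: leq_maxl.
  by apply: Jmono Jv; exact: leq_maxr.
have [s sU] := noetherian_fg noethA Uid.
have [N sN] : exists N, {in s, forall y, J N y}.
  have : {in s, forall y, U y} by move=> y ys; apply/sU; exact: ideal_gen_mem.
  elim: s {sU} => [|a s IHs] Us; first by exists 0%N.
  have [|N sN] := IHs; first by move=> y ys; apply: Us; rewrite inE ys orbT.
  have [M aM] := Us a (mem_head _ _).
  exists (maxn M N) => y; rewrite inE => /orP[/eqP->|/sN].
    by apply: Jmono aM; exact: leq_maxl.
  by apply: Jmono; exact: leq_maxr.
apply: (fP (iter N f (exist _ J0 FJ0))).2 => y Jy.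
by apply: (ideal_gen_min (Jid N) sN); apply/sU; exists N.+1.
Qed.

Lemma noetherian_ind (A : comNzRingType) (Pr : set A -> Prop) :
  noetherian A ->
  (forall J, ideal_set J ->
     (forall K, ideal_set K -> J `<=` K -> ~ K `<=` J -> Pr K) -> Pr J) ->
  forall J, ideal_set J -> Pr J.
Proof.
move=> noethA IH J idJ; apply: contrapT => nJ.
have [||K [idK nK] Kmax] :=
    @noetherian_max A [set K | ideal_set K /\ ~ Pr K] noethA.
- by move=> K [].
- by exists J.
- apply: nK; apply: IH => // L idL KL LK; apply: contrapT => nL.
  by apply: LK; exact: Kmax.
Qed.

(** An ideal K maximal among those containing J and missing S is prime: for u, v outside K, both K +
    (u) and K + (v) meet S, and a product of two such elements lies in K + (uv). *)
Lemma prime_avoiding (A : comNzRingType) (J S : set A) :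
  noetherian A -> ideal_set J -> S 1 ->
  (forall u v, S u -> S v -> S (u * v)) -> (forall y, J y -> ~ S y) ->
  exists P : prime_idealr A,
    (forall y, J y -> y \in P) /\ (forall y, S y -> y \notin P).
Proof.
move=> noethA idJ S1 SM JS.
have [||K [idK [JK KS]] Kmax] := @noetherian_max A
    [set K | ideal_set K /\ J `<=` K /\ forall y, K y -> ~ S y] noethA.
- by move=> K [].
- by exists J; split=> //; split.
have meetS u : ~ K u -> exists r w, K w /\ S (r * u + w).
  move=> nKu; apply: contrapT => h; apply: nKu.
  apply: (Kmax [set y | exists r w, K w /\ y = r * u + w]).
  - split; [split|split].
    + by exists 0, 0; split; [exact: idK.1|rewrite mul0r add0r].
    + move=> r _ _ [p [w [Kw ->]]] [q [z [Kz ->]]].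
      exists (r * p + q), (r * w + z); split; first exact: idK.2.
      by ring.
    + by move=> y /JK Ky; exists 0, y; split=> //; rewrite mul0r add0r.
    + by move=> _ [r [w [Kw ->]]] Sy; apply: h; exists r, w.
  - by move=> y Ky; exists 0, y; split=> //; rewrite mul0r add0r.
  - by exists 1, 0; split; [exact: idK.1|rewrite mul1r addr0].
have [||P PK] := prime_of_set idK.
- by move=> /KS; exact.
- move=> u v Kuv; apply: contrapT => /not_orP[/meetS[p [w [Kw Sw]]]].
  move=> /meetS[q [z [Kz Sz]]]; apply: (KS _ _ (SM _ _ Sw Sz)).
  have -> : (p * u + w) * (q * v + z)
      = (p * q) * (u * v) + (z * w + ((p * u) * z + (q * v) * w)) by ring.
  by do ?[apply: (ideal_setD idK)]; exact: ideal_setM.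
exists P; split=> y; first by move=> /JK/PK.
by move=> Sy; apply/negP => /PK/KS.
Qed.

(** The primes missing all products s g^n, with s outside P, are those inside P that miss g. *)
Lemma prime_below (A : comNzRingType) (J : set A) (P : prime_idealr A) (g : A) :
  noetherian A -> ideal_set J ->
  (forall s n, s \notin P -> ~ J (s * g ^+ n)) ->
  exists Q : prime_idealr A,
    [/\ forall y, J y -> y \in Q, {subset Q <= P} & g \notin Q].
Proof.
move=> noethA idJ JS.
have P1 : 1 \notin P by rewrite idealr1.
have [||y|Q [JQ QS]] := @prime_avoiding A J
    [set y | exists s n, s \notin P /\ y = s * g ^+ n] noethA idJ.
- by exists 1, 0%N; rewrite mulr1.
- move=> _ _ [s [m [sP ->]]] [t [n [tP ->]]]; exists (s * t), (m + n)%N.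
  by rewrite exprD mulrACA prime_idealrM negb_or sP tP.
- by move=> Jy [s [n [/JS sP yE]]]; rewrite yE in Jy; exact: (sP n).
exists Q; split=> //.
  move=> y yQ; apply: contraLR (yQ) => yP; apply: QS.
  by exists y, 0%N; rewrite mulr1.
by apply: QS; exists 1, 1%N; rewrite mul1r.
Qed.

(* With t maximizing (rad I : t) among the t outside rad I, this colon ideal   *)
(* is prime, and t witnesses its minimality.                                   *)
Lemma minimal_prime_exists (A : comNzRingType) (I : {pred A}) :
  noetherian A -> is_ideal I -> 1 \notin I ->
  exists P : prime_idealr A, minimal_prime I P.
Proof.
move=> noethA /is_ideal_set idI I1.
pose rad : set A := [set y | forall Q : prime_idealr A, {subset I <= Q} -> y \in Q].
pose colon t : set A := [set y | rad (t * y)].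
have colonid t : ideal_set (colon t).
  split=> [Q _|r u v cu cv Q IQ]; first by rewrite mulr0 idealr0.
  have -> : t * (r * u + v) = r * (t * u) + t * v by ring.
  by have [_] := prime_ideal_set Q; apply; [exact: cu|exact: cv].
have [|||P0 [IP0 _]] := @prime_avoiding A [set` I] [set 1] noethA idI.
- by [].
- by move=> u v -> ->; rewrite mulr1.
- by move=> y /= yI y1; move: I1; rewrite -y1 yI.
have [||_ [t radt ->] cmax] := @noetherian_max A
    [set K | exists2 t, ~ rad t & K = colon t] noethA.
- by move=> _ [t _ ->].
- exists (colon 1), 1 => // /(_ P0 IP0); by rewrite idealr1.
have [||P Pt] := prime_of_set (colonid t).
- by rewrite /colon /= mulr1.
- move=> u v tuv; have [tu|tu] := pselect (colon t u); first by left.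
  right; apply: (cmax (colon (t * u))); first by exists (t * u).
    move=> y ty Q IQ.
    by have := idealMr u (ty Q IQ); rewrite mulrA [u * t]mulrC.
  by move=> Q IQ; rewrite -mulrA; exact: tuv.
have tP : t \notin P.
  apply/negP => /Pt tt; apply: radt => Q IQ.
  by have := tt Q IQ; rewrite prime_idealrM orbb.
exists P; split; first by move=> y yI; apply/Pt => Q IQ; apply: idealMr; exact: IQ.
move=> Q IQ QP y /Pt/(_ Q IQ); rewrite prime_idealrM => /orP[/QP|//].
by rewrite (negPf tP).
Qed.

(** * Saturation at a prime, and Krull's height theorem for two elements *)

(** The contraction to A of J A_P; ideals of A_P are handled as saturated ideals of A. *)
Definition sat (A : comNzRingType) (P : prime_idealr A) (J : set A) : set A :=
  [set y | exists2 s, s \notin P & J (s * y)].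

Definition saturated (A : comNzRingType) (P : prime_idealr A) (J : set A) :=
  sat P J `<=` J.

Lemma sub_sat (A : comNzRingType) (P : prime_idealr A) (J : set A) :
  J `<=` sat P J.
Proof. by move=> y Jy; exists 1; rewrite ?idealr1 ?mul1r. Qed.

Lemma sat_mono (A : comNzRingType) (P : prime_idealr A) (J K : set A) :
  J `<=` K -> sat P J `<=` sat P K.
Proof. by move=> JK y [s sP /JK Ksy]; exists s. Qed.

Lemma sat_ideal (A : comNzRingType) (P : prime_idealr A) (J : set A) :
  ideal_set J -> ideal_set (sat P J).
Proof.
move=> idJ; split; first by apply: sub_sat; exact: idJ.1.
move=> r u v [s sP su] [t tP tv]; exists (s * t); first exact: Localization.mul_notin.
have -> : s * t * (r * u + v) = (t * r) * (s * u) + s * (t * v) by ring.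
by apply: idJ.2 => //; exact: ideal_setM.
Qed.

Lemma sat_saturated (A : comNzRingType) (P : prime_idealr A) (J : set A) :
  saturated P (sat P J).
Proof.
move=> y [s sP [t tP tsy]]; exists (t * s); first exact: Localization.mul_notin.
by rewrite -mulrA.
Qed.

Definition add_gen (A : comNzRingType) (J : set A) (z : A) : set A :=
  [set y | exists r, J (y - r * z)].

Lemma sub_add_gen (A : comNzRingType) (J : set A) (z : A) : J `<=` add_gen J z.
Proof. by move=> y Jy; exists 0; rewrite ?mul0r ?subr0. Qed.

Lemma mem_add_gen (A : comNzRingType) (J : set A) (z : A) :
  ideal_set J -> add_gen J z z.
Proof. by move=> idJ; exists 1; rewrite ?mul1r ?subrr; first exact: idJ.1. Qed.

Lemma add_gen_mono (A : comNzRingType) (J K : set A) (z : A) :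
  J `<=` K -> add_gen J z `<=` add_gen K z.
Proof. by move=> JK y [r /JK Ky]; exists r. Qed.

Lemma add_gen_ideal (A : comNzRingType) (J : set A) (z : A) :
  ideal_set J -> ideal_set (add_gen J z).
Proof.
move=> idJ; split; first by apply: sub_add_gen; exact: idJ.1.
move=> r u v [p Ju] [q Jv]; exists (r * p + q).
have -> : r * u + v - (r * p + q) * z = r * (u - p * z) + (v - q * z) by ring.
exact: idJ.2.
Qed.

Lemma add_gen_min (A : comNzRingType) (J K : set A) (z : A) :
  ideal_set K -> J `<=` K -> K z -> add_gen J z `<=` K.
Proof.
move=> idK JK Kz y [r /JK Ky]; rewrite -[y](subrK (r * z)).
by apply: ideal_setD => //; exact: ideal_setM.
Qed.

(* The hypothesis says that A_P / J A_P has a single prime; this is the       *)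
(* descending chain condition for its ideals.                                  *)
Lemma saturated_dcc (A : comNzRingType) (P : prime_idealr A) (J : set A) :
  noetherian A -> ideal_set J -> saturated P J ->
  (forall Q : prime_idealr A,
     (forall y, J y -> y \in Q) -> {subset Q <= P} -> {subset P <= Q}) ->
  forall K : nat -> set A,
    (forall n, ideal_set (K n)) -> (forall n, saturated P (K n)) ->
    (forall n, J `<=` K n) -> (forall n, K n.+1 `<=` K n) ->
    exists N, forall n, (N <= n)%N -> K n `<=` K n.+1.
Proof.
move=> noethA; move: J; apply: noetherian_ind => // J idJ IH satJ minP K.
move=> idK satK JK decK.
have [J1|J1] := pselect (J 1).
  exists 0%N => n _ y _; apply: JK; rewrite -[y]mulr1; exact: ideal_setM.
pose colon t : set A := [set y | J (t * y)].
have colonid t : ideal_set (colon t).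
  split; first by rewrite /colon /= mulr0; exact: idJ.1.
  move=> r u v cu cv.
  have -> : colon t (r * u + v) = J (r * (t * u) + t * v).
    by rewrite /colon /=; congr (J _); ring.
  exact: idJ.2.
(* A maximal colon ideal J : z with z outside J is prime. Saturation puts it inside P, so it equals
   P, and induction applies to the saturation of J + (z). *)
have [||_ [z Jz ->] cmax] := @noetherian_max A
    [set L | exists2 t, ~ J t & L = colon t] noethA.
- by move=> _ [t _ ->].
- by exists (colon 1), 1.
have [||Q Qz] := prime_of_set (colonid z).
- by rewrite /colon /= mulr1.
- move=> u v zuv; have [zu|zu] := pselect (colon z u); first by left.
  right; apply: (cmax (colon (z * u))); first by exists (z * u).
    move=> y zy; rewrite /colon /= -mulrA mulrCA; exact: ideal_setM.
  by rewrite /colon /= -mulrA.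
have PQ : {subset P <= Q}.
  apply: minP => y; first by move=> Jy; apply/Qz; exact: ideal_setM.
  move=> /Qz zy; apply: contrapT => /negP yP; apply: Jz; apply: satJ.
  by exists y; rewrite // mulrC.
have Pz r : r \in P -> J (r * z) by move=> /PQ/Qz; rewrite mulrC.
pose K' n := sat P (add_gen (K n) z).
have [N NK'] : exists N, forall n, (N <= n)%N -> K' n `<=` K' n.+1.
  apply: (IH (sat P (add_gen J z))).
  - exact/sat_ideal/add_gen_ideal.
  - by move=> y Jy; apply: sub_sat; exact: sub_add_gen.
  - by move=> h; apply: Jz; apply: h; apply: sub_sat; exact: mem_add_gen.
  - exact: sat_saturated.
  - move=> Q' JQ'; apply: minP => y Jy; apply: JQ'; apply: sub_sat.
    exact: sub_add_gen.
  - by move=> n; exact/sat_ideal/add_gen_ideal.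
  - by move=> n; exact: sat_saturated.
  - by move=> n; apply: sat_mono; apply: add_gen_mono.
  - by move=> n; apply: sat_mono; apply: add_gen_mono.
(* Either every [K n] contains z and absorbs it, or z leaves the chain at M; from then on r z in
   [K n] forces r into P, whence r z is in J. *)
have [zK|/existsNP[M zM]] := pselect (forall n, K n z).
  exists N => n Nn y Ky.
  have /(NK' _ Nn)[s sP sy] : K' n y by apply: sub_sat; exact: sub_add_gen.
  apply: satK; exists s => //; apply: (add_gen_min (idK _) _ _ sy) => //.
have zK n : (M <= n)%N -> ~ K n z.
  move=> /subnK<-; elim: (n - M)%N => // k IHk; rewrite addSn => /decK.
  exact: IHk.
exists (maxn M N) => n; rewrite geq_max => /andP[Mn Nn] y Ky.
have /(NK' _ Nn)[s sP [r Ksy]] : K' n y.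
  by apply: sub_sat; exact: sub_add_gen.
have rz : K n (r * z).
  rewrite -[r * z](subKr (s * y)); apply: ideal_setB => //.
    exact: ideal_setM.
  exact: decK.
have [rP|rP] := boolP (r \in P); last first.
  by case: (zK n Mn); apply: satK; exists r.
apply: satK; exists s => //; rewrite -[s * y](subrK (r * z)).
by apply: ideal_setD => //; apply: JK; exact: Pz.
Qed.

(** Locally at P the hypothesis reads: K lies in J + v K. By induction on generators of K: in its
    own relation, a generator a has coefficient s - v r outside P, so it can be eliminated from the
    other relations. *)
Lemma nakayama (A : comNzRingType) (P : prime_idealr A) (J K : set A) (v : A) :
  noetherian A -> ideal_set J -> saturated P J -> ideal_set K -> v \in P ->
  (forall y, K y -> exists s k, [/\ s \notin P, K k & J (s * y - v * k)]) ->
  K `<=` J.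
Proof.
move=> noethA idJ satJ idK vP KvK.
have [g Kg] := noetherian_fg noethA idK.
have gK : {in g, forall y, K y} by move=> y yg; apply/Kg; exact: ideal_gen_mem.
have {KvK} KvK y : y \in g -> exists s k,
    [/\ s \notin P, k \in ideal_gen g & J (s * y - v * k)].
  by move=> /gK/KvK[s [k [sP Kk Jy]]]; exists s, k; split=> //; apply/Kg.
suff Jg : {in g, forall y, J y} by move=> y /Kg; exact: ideal_gen_min.
elim: g {Kg gK} KvK => // a g IHg KvK.
have [s [_ [sP /ideal_gen_cons[r [k [kg ->]] Ja]]]] := KvK a (mem_head _ _).
pose t := s - v * r.
have tP : t \notin P.
  apply: contra sP => tP; rewrite -[s](subrK (v * r)).
  by apply: rpredD => //; rewrite mulrC; exact: idealMr.
have {}Ja : J (t * a - v * k).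
  by have -> : t * a - v * k = s * a - v * (r * a + k) by rewrite /t; ring.
have gJ : {in g, forall y, J y}.
  apply: IHg => y yg.
  have [|s' [_ [s'P /ideal_gen_cons[r' [k' [k'g ->]] Jy]]]] := KvK y.
    by rewrite inE yg orbT.
  exists (t * s'), (t * k' + r' * v * k); split; first exact: Localization.mul_notin.
    have idg := ideal_gen_set g; apply: (ideal_setD idg); exact: (ideal_setM _ idg).
  have -> : t * s' * y - v * (t * k' + r' * v * k)
      = t * (s' * y - v * (r' * a + k')) + v * r' * (t * a - v * k) by ring.
  by apply: ideal_setD => //; exact: ideal_setM.
move=> y; rewrite inE => /orP[/eqP->|/gJ//]; apply: satJ; exists t => //.
rewrite -[t * a](subrK (v * k)); apply: ideal_setD => //; apply: ideal_setM => //.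
exact: ideal_gen_min kg.
Qed.

(* Krull's principal ideal theorem in the domain A / Q'.  For y in Q outside  *)
(* Q', the ideals C n = (y^n) A_Q + Q' contracted to A descend, and the chain *)
(* condition modulo v together with Nakayama's lemma makes them stationary:   *)
(* y^n lies in C (n + 1), which forces a unit of A_Q into Q.                  *)
Lemma krull_principal (A : comNzRingType) (Q' Q P : prime_idealr A) (v : A) :
  noetherian A -> {subset Q' <= Q} -> ~ {subset Q <= Q'} -> {subset Q <= P} ->
  v \in P ->
  (forall R : prime_idealr A, {subset Q' <= R} -> v \in R -> {subset R <= P} ->
     {subset P <= R}) ->
  {subset P <= Q}.
Proof.
move=> noethA Q'Q QQ' QP vP minP.
have [vQ|vQ] := boolP (v \in Q); first exact: minP.
have [y /andP[yQ yQ']] : exists y, (y \in Q) && (y \notin Q').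
  apply: contrapT => /forallNP h; apply: QQ' => y yQ.
  by have /negP := h y; rewrite yQ /= negbK.
pose C n := sat Q (add_gen [set` Q'] (y ^+ n)).
have idQ' := prime_ideal_set Q'.
have idC n : ideal_set (C n) by exact/sat_ideal/add_gen_ideal.
have satCQ n : saturated Q (C n) by exact: sat_saturated.
have satCP n : saturated P (C n).
  by move=> z [s sP Cz]; apply: satCQ; exists s => //; apply: contra sP => /QP.
have decC n : C n.+1 `<=` C n.
  apply: sat_mono; apply: add_gen_min; first exact: add_gen_ideal.
    exact: sub_add_gen.
  by rewrite exprS; apply: ideal_setM; [exact: add_gen_ideal|exact: mem_add_gen].
have Q'C n : [set` Q'] `<=` C n.
  by move=> z Q'z; apply: sub_sat; exact: sub_add_gen.
have [N NK] : exists N, forall n, (N <= n)%N ->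
    sat P (add_gen (C n) v) `<=` sat P (add_gen (C n.+1) v).
  apply: (@saturated_dcc _ P (sat P (add_gen [set` Q'] v))) => //.
  - exact/sat_ideal/add_gen_ideal.
  - exact: sat_saturated.
  - move=> R JR; apply: minP.
      by move=> z zQ'; apply: JR; apply: sub_sat; exact: sub_add_gen.
    by apply: JR; apply: sub_sat; exact: mem_add_gen.
  - by move=> n; exact/sat_ideal/add_gen_ideal.
  - by move=> n; exact: sat_saturated.
  - by move=> n; apply: sat_mono; apply: add_gen_mono; exact: Q'C.
  - by move=> n; apply: sat_mono; apply: add_gen_mono; exact: decC.
have CN : C N `<=` C N.+1.
  apply: (@nakayama _ P _ _ v) => // z Cz.
  have [s sP [r Cr]] : sat P (add_gen (C N.+1) v) z.
    by apply: (NK N) => //; apply: sub_sat; exact: sub_add_gen.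
  exists s, r; split=> //; last by rewrite [v * r]mulrC.
  (* v is outside Q and [C N] is saturated at Q, so r v in [C N] gives r in [C N]. *)
  apply: satCQ; exists v => //; rewrite mulrC -[r * v](subKr (s * z)).
  by apply: ideal_setB => //; [exact: ideal_setM|exact: decC].
have [t tQ [r]] : C N.+1 (y ^+ N).
  by apply: CN; apply: sub_sat; exact: mem_add_gen.
have -> : t * y ^+ N - r * y ^+ N.+1 = (t - r * y) * y ^+ N.
  by rewrite exprS; ring.
rewrite /= prime_idealrM => /orP[/Q'Q tQ'|/prime_idealX]; last by rewrite (negPf yQ').
case/negP: tQ; rewrite -[t](subrK (r * y)); apply: rpredD => //.
exact: idealMr.
Qed.

(** Enlarge Q2 to a prime Q maximal among those properly inside P, say with v outside Q. Then P is
    minimal over Q + (v), so Q contains some q = s w^n - r v with s outside P. A prime R properly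
    inside Q and containing q would leave P minimal over R + (v), against [krull_principal]. So Q is
    minimal over q, and [krull_principal] again forbids Q0 < Q1 < Q. *)
Lemma krull_two (A : comNzRingType) (Q0 Q1 Q2 P : prime_idealr A) (v w : A) :
  noetherian A -> {subset Q0 <= Q1} -> ~ {subset Q1 <= Q0} ->
  {subset Q1 <= Q2} -> ~ {subset Q2 <= Q1} -> {subset Q2 <= P} ->
  v \in P -> w \in P ->
  (forall R : prime_idealr A, v \in R -> w \in R -> {subset R <= P} ->
     {subset P <= R}) ->
  {subset P <= Q2}.
Proof.
move=> noethA Q01 Q10 Q12 Q21 Q2P vP wP minP; apply: contrapT => PQ2.
have [||_ [Q [Q2Q [QP [PQ ->]]]] Qmax] := @noetherian_max A
    [set K | exists Q : prime_idealr A, {subset Q2 <= Q} /\ {subset Q <= P} /\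
       ~ {subset P <= Q} /\ K = [set` Q]] noethA.
- by move=> _ [Q [_ [_ [_ ->]]]]; exact: prime_ideal_set.
- exists [set` Q2], Q2; do !split=> //; exact: PQ2.
wlog vQ : v w vP wP minP / v \notin Q.
  move=> wlg; have [vQ|] := boolP (v \in Q); last exact: (wlg v w).
  have [wQ|] := boolP (w \in Q); first by case: PQ; exact: minP.
  by apply: (wlg w v) => // R wR vR; exact: minP.
have minQv (R : prime_idealr A) :
    {subset Q <= R} -> v \in R -> {subset R <= P} -> {subset P <= R}.
  move=> QR vR RP; apply: contrapT => PR; case/negP: vQ.
  apply: (Qmax [set` R]) => //; exists R; split=> // y /Q2Q; exact: QR.
have [s [n [sP [r wr]]]] : exists s n,
    s \notin P /\ add_gen [set` Q] v (s * w ^+ n).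
  apply: contrapT => nsn.
  have [||R [QR RP wR]] := @prime_below A (add_gen [set` Q] v) P w noethA.
  - exact/add_gen_ideal/prime_ideal_set.
  - by move=> s n sP Qs; apply: nsn; exists s, n.
  - case/negP: wR; apply: minQv wP => // [y yQ|].
      by apply: QR; exact: sub_add_gen.
    by apply: QR; apply: mem_add_gen; exact: prime_ideal_set.
set q := s * w ^+ n - r * v in wr.
have minq (R : prime_idealr A) : q \in R -> {subset R <= Q} -> {subset Q <= R}.
  move=> qR RQ; apply: contrapT => QR; apply: PQ.
  apply: (@krull_principal A R Q P v) => // T RT vT TP; apply: minP => //.
  have : s * w ^+ n \in T.
    rewrite -[_ * _](subrK (r * v)); apply: rpredD; first exact: RT.
    exact: idealMr.
  rewrite prime_idealrM => /orP[/TP|/prime_idealX//].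
  by rewrite (negPf sP).
apply: Q21 => y /Q2Q; apply: (@krull_principal A Q0 Q1 Q q) => //.
  by move=> z /Q12/Q2Q.
by move=> R _; exact: minq.
Qed.

(** * Lower and upper bounds for height two *)

(** g is regular modulo f, so P contains a prime Q1 over f missing g; f is regular in A, so Q1
    contains a prime Q0 missing f. *)
Lemma regular_sequence2_chain (A : comNzRingType) (f g : A)
    (P : prime_idealr A) :
  noetherian A -> regular_sequence [:: f; g] -> f \in P -> g \in P ->
  prime_chain P 2.
Proof.
move=> noethA [_ reg] fP gP.
have f_reg y : f * y = 0 -> y = 0.
  by move=> fy; apply/ideal_gen_nil; apply: (reg 0%N) => //; apply/ideal_gen_nil.
have g_reg y : g * y \in ideal_gen [:: f] -> y \in ideal_gen [:: f].
  exact: (reg 1%N).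
have [||Q1 [fQ1 Q1P gQ1]] := @prime_below A [set` ideal_gen [:: f]] P g noethA.
- exact: ideal_gen_set.
- move=> s n sP; elim: n => [|n IHn].
    rewrite mulr1 => /= /ideal_gen1[r sE]; case/negP: sP; rewrite sE.
    exact: idealMr.
  by rewrite exprS mulrCA => /g_reg.
have [||Q0 [_ Q01 fQ0]] := @prime_below A [set 0] Q1 f noethA.
- by split=> // r u v -> ->; rewrite mulr0 addr0.
- move=> s n sQ1; elim: n => [|n IHn].
    by rewrite mulr1 => s0; case/negP: sQ1; rewrite s0 idealr0.
  by rewrite exprS mulrCA => /f_reg.
have {}fQ1 : f \in Q1 by apply: fQ1; apply: ideal_gen_mem; rewrite mem_head.
(* Index 2 runs off the list and returns the default P, the top of the chain. *)
exists (nth P [:: Q0; Q1]); split=> // -[|[|//]] _ /=; split=> //.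
  by move=> /(_ _ fQ1); rewrite (negPf fQ0).
by move=> /(_ _ gP); rewrite (negPf gQ1).
Qed.

Lemma krull_height2 (A : comNzRingType) (P : prime_idealr A) (v w : A) :
  noetherian A -> v \in P -> w \in P ->
  (forall R : prime_idealr A, v \in R -> w \in R -> {subset R <= P} ->
     {subset P <= R}) ->
  forall m, prime_chain P m -> (m <= 2)%N.
Proof.
move=> noethA vP wP minP m [Q [QmP Qchain]]; rewrite leqNgt; apply/negP => m3.
have [n mE] : exists n, m = n.+3 by exists (m - 3)%N; rewrite -addn3 subnK.
subst m.
have [|Q01 Q10] := Qchain n; first by rewrite ltnS ltnW.
have [|Q12 Q21] := Qchain n.+1; first by rewrite ltnS.
have [|Q23 Q32] := Qchain n.+2; first by [].
apply: Q32 => y; rewrite QmP; apply: (@krull_two A (Q n) (Q n.+1) _ _ v w) => //.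
by move=> z /Q23; rewrite QmP.
Qed.

(** * Primes of the localization *)

Lemma loc_contract (A : comNzRingType) (P : prime_idealr A)
    (R : prime_idealr (localization P)) :
  exists2 Q : prime_idealr A,
    forall y, (y \in Q) <-> (loc_map P y \in R) & {subset Q <= P}.
Proof.
have [|||Q QR] := @prime_of_set A [set y | loc_map P y \in R].
- split=> [|r u v /= uR vR]; first by rewrite /= rmorph0 idealr0.
  by rewrite rmorphD rmorphM; apply: rpredD => //; exact: idealMr.
- by rewrite /= rmorph1 idealr1.
- by move=> u v; rewrite /= rmorphM prime_idealrM => /orP.
exists Q => // y /QR yR; apply: contraT => /loc_map_inv[z yz].
by have := idealMr z yR; rewrite mulrC yz idealr1.
Qed.

Lemma loc_map_inj (A : comNzRingType) (P : prime_idealr A) (r s : A) :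
  loc_map P r = loc_map P s -> exists2 u, u \notin P & u * r = u * s.
Proof.
move=> rs; have /loc_map_eq0[u uP u0] : loc_map P (r - s) = 0.
  by rewrite rmorphB /= rs subrr.
by exists u => //; apply/eqP; rewrite -subr_eq0 -mulrBr u0.
Qed.

Lemma loc_extend (A : comNzRingType) (P Q : prime_idealr A) :
  {subset Q <= P} ->
  exists R : prime_idealr (localization P),
    forall y, (y \in Q) <-> (loc_map P y \in R).
Proof.
move=> QP; have QnP s : s \notin P -> s \notin Q by apply: contra => /QP.
pose E : set (localization P) := [set z | exists r s,
  [/\ s \notin P, r \in Q & z * loc_map P s = loc_map P r]].
have EQ y : E (loc_map P y) -> y \in Q.
  move=> [r [s [sP rQ]]]; rewrite -rmorphM => /loc_map_inj[u uP uE].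
  have : u * (y * s) \in Q by rewrite uE; exact: idealMr.
  by rewrite !prime_idealrM (negPf (QnP _ uP)) (negPf (QnP _ sP)) orbF.
have QE y : y \in Q -> E (loc_map P y).
  by move=> yQ; exists y, 1; rewrite rmorph1 mulr1 idealr1.
have [|||R RE] := @prime_of_set _ E.
- split=> [|z u v]; first by rewrite -(rmorph0 (loc_map P)); apply: QE; exact: idealr0.
  move=> [r [s [sP rQ us]]] [r' [s' [s'P r'Q vs]]].
  have [c [d [dP zd]]] := loc_map_surj z.
  exists (c * r * s' + d * s * r'), (d * s * s'); split.
  + by do ?[apply: Localization.mul_notin].
  + by apply: rpredD; [rewrite mulrC mulrA|]; exact: idealMr.
  + by rewrite !(rmorphD, rmorphM) /= -us -vs -zd; ring.
- by rewrite -(rmorph1 (loc_map P)) => /EQ; rewrite idealr1.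
- move=> u v [r [s [sP rQ uvs]]].
  have [c [d [dP ud]]] := loc_map_surj u.
  have [c' [d' [d'P vd]]] := loc_map_surj v.
  have /EQ : E (loc_map P (c * c')).
    exists (d * d' * r), s; split=> //; first exact: idealMr.
    by rewrite !rmorphM /= -uvs -ud -vd; ring.
  by rewrite prime_idealrM => /orP[cQ|cQ]; [left; exists c, d|right; exists c', d'].
by exists R => y; rewrite RE; split=> [/QE|/EQ].
Qed.

Lemma loc_num_in (A : comNzRingType) (P : prime_idealr A)
    (R : prime_idealr (localization P)) (r s : A) (z : localization P) :
  s \notin P -> z * loc_map P s = loc_map P r -> (z \in R) = (loc_map P r \in R).
Proof.
move=> /loc_map_inv[z' sz'] <-; rewrite prime_idealrM orbC.
case: (boolP (loc_map P s \in R)) => // sR.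
by have := idealMr z' sR; rewrite mulrC sz' idealr1.
Qed.

(** Contraction and extension match the primes of A_P with the primes inside P and preserve strict
    inclusions; the hypothesis says that R corresponds to P. *)
Lemma loc_prime_chain (A : comNzRingType) (P : prime_idealr A)
    (R : prime_idealr (localization P)) (m : nat) :
  (forall y, (y \in P) <-> (loc_map P y \in R)) ->
  prime_chain R m <-> prime_chain P m.
Proof.
move=> PR; split=> -[Q [QmP Qchain]].
  have /choice[S SP] i : exists S : prime_idealr A,
      forall y, (y \in S) <-> (loc_map P y \in Q i).
    by have [S SQ _] := loc_contract (Q i); exists S.
  exists S; split=> [y|i im].
    by apply/idP/idP => [/SP|/PR]; rewrite ?QmP => h; [exact/PR|apply/SP; rewrite QmP].
  have [QS nQS] := Qchain i im; split=> [y /SP/QS/SP//|SS]; apply: nQS => z zQ.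
  have [r [s [sP zs]]] := loc_map_surj z; rewrite (loc_num_in _ sP zs).
  by apply/SP/SS/SP; rewrite -(loc_num_in _ sP zs).
have QP i : (i <= m)%N -> {subset Q i <= P}.
  move=> /subnKC; move: (m - i)%N => k; elim: k i => [|k IHk] i.
    by rewrite addn0 => -> y; rewrite QmP.
  rewrite addnS -addSn => imE y yQ; apply: (IHk i.+1 imE).
  by apply: (Qchain i _).1 yQ; rewrite -imE addSn ltnS leq_addr.
have /choice[S SP] i : exists S : prime_idealr (localization P), (i <= m)%N ->
    forall y, (y \in Q i) <-> (loc_map P y \in S).
  (* Past m nothing places [Q i] inside P, and R is a filler value. *)
  have [im|_] := boolP (i <= m)%N; last by exists R.
  by have [S QS] := loc_extend (QP i im); exists S.
exists S; split=> [|i im].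
  move=> z; have [r [s [sP zs]]] := loc_map_surj z.
  rewrite !(loc_num_in _ sP zs); apply/idP/idP => [/(SP m (leqnn m))|/PR].
    by rewrite QmP => /PR.
  by rewrite -QmP => /(SP m (leqnn m)).
have [QS nQS] := Qchain i im; split=> [z|SS].
  have [r [s [sP zs]]] := loc_map_surj z; rewrite !(loc_num_in _ sP zs).
  by move=> /(SP i (ltnW im))/QS/(SP _ im).
by apply: nQS => y /(SP _ im)/SS/(SP i (ltnW im)).
Qed.

(** * Syzygies modulo [x1] *)

(** Lets [ring] prove an equation that follows from a hypothesis e = f. *)
Lemma eq_by_sub (A : zmodType) (e f u v : A) : e = f -> u - v = e - f -> u = v.
Proof. by move=> ->; rewrite subrr => /eqP; rewrite subr_eq0 => /eqP. Qed.

Lemma cancel_expr (A : comNzRingType) (x1 x2 : A) (k : nat) :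
  (forall y p, x2 * y = x1 * p -> exists q, y = x1 * q) ->
  forall y p, x2 ^+ k * y = x1 * p -> exists q, y = x1 * q.
Proof.
move=> reg2; elim: k => [|k IHk] y p; first by rewrite mul1r; exists p.
by rewrite exprS -mulrA => /reg2[q /IHk].
Qed.

(** Induction on k: if x3 y is in (x1, x2^(k+1)), then y = x1 r + x2 s, and cancelling x2 modulo x1
    puts x3 s in (x1, x2^k). *)
Lemma cancel_expr2 (A : comNzRingType) (x1 x2 x3 : A) (k l : nat) :
  (forall y p, x2 * y = x1 * p -> exists q, y = x1 * q) ->
  (forall y p q, x3 * y = x1 * p + x2 * q -> exists r s, y = x1 * r + x2 * s) ->
  forall y p q, x3 ^+ l * y = x1 * p + x2 ^+ k * q ->
  exists r s, y = x1 * r + x2 ^+ k * s.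
Proof.
move=> reg2 reg3.
have cancel1 : forall y p q, x3 * y = x1 * p + x2 ^+ k * q ->
    exists r s, y = x1 * r + x2 ^+ k * s.
  elim: k => [|k IHk] y p q E.
    by exists 0, y; rewrite mul1r mulr0 add0r.
  have [|r [s yE]] := reg3 y p (x2 ^+ k * q); first by rewrite E exprS mulrA.
  have [|t tE] := reg2 (x3 * s - x2 ^+ k * q) (p - x3 * r).
    by apply: (eq_by_sub E); rewrite yE exprS; ring.
  have [|r' [s' sE]] := IHk s t q; first by rewrite -tE subrK.
  exists (r + x2 * r'), s'; rewrite yE sE exprS; ring.
elim: l => [|l IHl] y p q; first by rewrite mul1r; exists p, q.
by rewrite exprS -mulrA => /cancel1[r [s /IHl]].
Qed.

(* The syzygies are those of the monomials obtained by setting x1 = 0, up to  *)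
(* multiples of x1; the two generators are the rows of the matrix whose 2x2   *)
(* minors are v1, v2 and D.                                                    *)
Lemma hn_syzygy (A : comNzRingType) (x1 x2 x3 : A)
    (a1 a2 a3 b1 b2 b3 : nat) (al be ga w : A) :
  (0 < a1)%N -> (0 < b1)%N ->
  (forall y p, x2 * y = x1 * p -> exists q, y = x1 * q) ->
  (forall y p q, x3 * y = x1 * p + x2 * q -> exists r s, y = x1 * r + x2 * s) ->
  al * (x1 ^+ (a1 + b1) - x2 ^+ b2 * x3 ^+ a3)
    + be * (x2 ^+ (a2 + b2) - x1 ^+ a1 * x3 ^+ b3)
    + ga * (x3 ^+ (a3 + b3) - x1 ^+ b1 * x2 ^+ a2) = x1 * w ->
  exists r s al' be' ga',
    [/\ al = r * x2 ^+ a2 + s * x3 ^+ b3 + x1 * al',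
        be = r * x3 ^+ a3 + s * x1 ^+ b1 + x1 * be' &
        ga = r * x1 ^+ a1 + s * x2 ^+ b2 + x1 * ga'].
Proof.
case: a1 b1 => // a1 [//|b1] _ _ reg2 reg3.
have canY := @cancel_expr _ _ _ a2 reg2.
have canY' := @cancel_expr _ _ _ b2 reg2.
have canZ := @cancel_expr2 _ _ _ _ (a2 + b2) a3 reg2 reg3.
have canZY := @cancel_expr2 _ _ _ _ a2 a3 reg2 reg3.
have canZ' := @cancel_expr2 _ _ _ _ b2 b3 reg2 reg3.
rewrite exprD in canZ; rewrite !exprD !exprS.
(* Here a1 and b1 are predecessors, so x1 p and x1 q are the original powers of x1. Modulo x1 the
   relation becomes - al Y' Z + be Y Y' + ga Z Z' = 0. *)
move: (x1 ^+ a1) (x1 ^+ b1) (x2 ^+ a2) (x2 ^+ b2) (x3 ^+ a3) (x3 ^+ b3)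
  => p q Y Y' Z Z' in canY canY' canZ canZY canZ' *.
move=> E.
(* Cancelling Z modulo (x1, Y Y') and Z' modulo (x1, Y') determines ga; cancelling Y' and then Z
   gives al, and cancelling Y gives be. *)
have [|p1 [q1 E1]] := canZ (ga * Z' - al * Y')
  (w - al * p * x1 * q + be * p * Z' + ga * q * Y) (- be).
  by apply: (eq_by_sub E); ring.
have [|g1 [s gaE]] := canZ' ga p1 (Y * q1 + al).
  by apply: (eq_by_sub E1); ring.
have [|p2 E2] := canY' (s * Z * Z' - al * Z + be * Y)
  (w - al * p * x1 * q + be * p * Z' + ga * q * Y - g1 * Z * Z').
  by apply: (eq_by_sub E); rewrite gaE; ring.
have [|p3 [q3 E3]] := canZY (s * Z' - al) p2 (- be).
  by apply: (eq_by_sub E2); ring.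
have alE : al = s * Z' - Y * q3 - x1 * p3 by apply: (eq_by_sub (esym E3)); ring.
have [|be1 E4] := canY (be + q3 * Z) (p2 - p3 * Z).
  by apply: (eq_by_sub E2); rewrite alE; ring.
(* The terms - s q and q3 p compensate for the row entries x1^b1 and x1^a1, which vanish modulo
   x1. *)
exists (- q3), s, (- p3), (be1 - s * q), (g1 + q3 * p); split.
- by rewrite alE; ring.
- by apply: (eq_by_sub E4); ring.
- by rewrite gaE; ring.
Qed.

(** * Number of generators, and the almost complete intersection property *)

(** Given two generators f, g, writing the v's in f, g and these back in the v's yields a matrix of
    rank at most two. By the hypothesis on syzygies it is the identity modulo m, so its determinant
    0 is 1 modulo m. *)
Lemma min_generators3 (A : comNzRingType) (m : set A) (v1 v2 v3 : A) :
  ideal_set m -> ~ m 1 ->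
  (forall al be ga, al * v1 + be * v2 + ga * v3 = 0 -> [/\ m al, m be & m ga]) ->
  min_generators (ideal_gen [:: v1; v2; v3]) 3.
Proof.
move=> idm m1 syz; split; first by exists [:: v1; v2; v3].
move=> n [s [<- Is]]; rewrite leqNgt; apply/negP => s3; apply: m1.
have [f [g {}Is]] : exists f g, ideal_gen [:: v1; v2; v3] =i ideal_gen [:: f; g].
  case: s s3 Is => [|f [|g [|//]]] _ Is.
  - exists 0, 0 => y; rewrite Is; apply/idP/idP => [/ideal_gen_nil->|].
      by apply/ideal_gen2; exists 0, 0; ring.
    by move=> /ideal_gen2[r [s ->]]; apply/ideal_gen_nil; ring.
  - exists f, 0 => y; rewrite Is; apply/idP/idP => [/ideal_gen1[r ->]|].
      by apply/ideal_gen2; exists r, 0; ring.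
    by move=> /ideal_gen2[r [s ->]]; apply/ideal_gen1; exists r; ring.
  - by exists f, g.
have vI v : v \in [:: v1; v2; v3] -> exists p q, v = p * f + q * g.
  by move=> vs; apply/ideal_gen2; rewrite -Is; exact: ideal_gen_mem.
have gI h : h \in [:: f; g] -> exists r s t, h = r * v1 + s * v2 + t * v3.
  by move=> hs; apply/ideal_gen3; rewrite Is; exact: ideal_gen_mem.
have [|p1 [q1 v1E]] := vI v1; first by rewrite !inE eqxx ?orbT.
have [|p2 [q2 v2E]] := vI v2; first by rewrite !inE eqxx ?orbT.
have [|p3 [q3 v3E]] := vI v3; first by rewrite !inE eqxx ?orbT.
have [|f1 [f2 [f3 fE]]] := gI f; first by rewrite !inE eqxx ?orbT.
have [|g1 [g2 [g3 gE]]] := gI g; first by rewrite !inE eqxx ?orbT.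
have row u p q al be ga : u = p * f + q * g -> u = al * v1 + be * v2 + ga * v3 ->
    [/\ m (al - (p * f1 + q * g1)), m (be - (p * f2 + q * g2))
      & m (ga - (p * f3 + q * g3))].
  move=> uE uE'; apply: syz.
  have -> : (al - (p * f1 + q * g1)) * v1 + (be - (p * f2 + q * g2)) * v2
      + (ga - (p * f3 + q * g3)) * v3
    = (al * v1 + be * v2 + ga * v3)
      - (p * (f1 * v1 + f2 * v2 + f3 * v3) + q * (g1 * v1 + g2 * v2 + g3 * v3)).
    by ring.
  by rewrite -uE' -fE -gE -uE subrr.
have [|m11 m12 m13] := row v1 p1 q1 1 0 0 v1E; first by ring.
have [|_ m22 _] := row v2 p2 q2 0 1 0 v2E; first by ring.
have [|_ m32 m33] := row v3 p3 q3 0 0 1 v3E; first by ring.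
move: m11 m12 m13 m22 m32 m33.
set e11 := 1 - _; set e12 := 0 - _; set e13 := 0 - _; set e22 := 1 - _.
set e32 := 0 - _; set e33 := 1 - _ => m11 m12 m13 m22 m32 m33.
pose e21 := 0 - (p2 * f1 + q2 * g1); pose e23 := 0 - (p2 * f3 + q2 * g3).
pose e31 := 0 - (p3 * f1 + q3 * g1).
(* The matrix 1 - e is a product of a 3x2 and a 2x3 matrix, so det (1 - e) = 0. *)
have -> : 1 = ((1 - e22) * (1 - e33) - e23 * e32) * e11 + (1 - e33) * e22 + e33
    + e23 * e32 + (e21 * (1 - e33) + e23 * e31) * e12
    + (e21 * e32 + (1 - e22) * e31) * e13.
  by rewrite /e11 /e12 /e13 /e21 /e22 /e23 /e31 /e32 /e33; ring.
by do ?[assumption | exact: ideal_setM | apply: (ideal_setD idm)].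
Qed.

Lemma loc_ideal_gen3 (A : comNzRingType) (P : prime_idealr A)
    (v w t p q r u : A) :
  r \notin P -> r * t = - (p * v + q * w) -> u \in ideal_gen [:: v; w; t] ->
  loc_map P u \in ideal_gen [:: loc_map P v; loc_map P w].
Proof.
move=> /loc_map_inv[d rd] /(congr1 (loc_map P)) E /ideal_gen3[a [b [c ->]]].
apply/ideal_gen2; exists (loc_map P a - loc_map P c * d * loc_map P p),
  (loc_map P b - loc_map P c * d * loc_map P q).
rewrite !(rmorphN, rmorphD, rmorphM) /= in E *.
rewrite -[loc_map P t]mul1r -rd mulrAC E; ring.
Qed.

Theorem proposition6p3 (A : comNzRingType) (x1 x2 x3 : A)
    (a1 a2 a3 b1 b2 b3 : nat) :
  noetherian A ->
  1 \notin ideal_gen [:: x1; x2; x3] ->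
  height (ideal_gen [:: x1; x2; x3]) 3 ->
  (0 < a1)%N -> (0 < a2)%N -> (0 < a3)%N ->
  (0 < b1)%N -> (0 < b2)%N -> (0 < b3)%N ->
  let c1 := (a1 + b1)%N in
  let c2 := (a2 + b2)%N in
  let c3 := (a3 + b3)%N in
  let v1 := x1 ^+ c1 - x2 ^+ b2 * x3 ^+ a3 in
  let v2 := x2 ^+ c2 - x1 ^+ a1 * x3 ^+ b3 in
  let D := x3 ^+ c3 - x1 ^+ b1 * x2 ^+ a2 in
  regular_sequence [:: x1; x2; x3] ->
  grade (ideal_gen [:: v1; v2]) 2 ->
  almost_complete_intersection (ideal_gen [:: v1; v2; D]).
Proof.
move=> noethA x1N _ a1_gt0 a2_gt0 a3_gt0 b1_gt0 b2_gt0 b3_gt0 c1 c2 c3 v1 v2 D.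
move=> [_ reg] [[s [s2 sv s_reg]] _].
have reg1 y : x1 * y = 0 -> y = 0.
  by move=> xy; apply/ideal_gen_nil; apply: (reg 0%N) => //; apply/ideal_gen_nil.
have reg2 y p : x2 * y = x1 * p -> exists q, y = x1 * q.
  move=> xy; have /ideal_gen1[q ->] : y \in ideal_gen [:: x1].
    by apply: (reg 1%N) => //=; rewrite xy; apply/ideal_gen1; exists p; ring.
  by exists q; ring.
have reg3 y p q : x3 * y = x1 * p + x2 * q -> exists r s, y = x1 * r + x2 * s.
  move=> xy; have /ideal_gen2[r [t ->]] : y \in ideal_gen [:: x1; x2].
    by apply: (reg 2%N) => //=; rewrite xy; apply/ideal_gen2; exists p, q; ring.
  by exists r, t; ring.
pose I := ideal_gen [:: v1; v2; D]; rewrite -/I.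
pose m : set A := [set` ideal_gen [:: x1; x2; x3]].
have idm : ideal_set m := ideal_gen_set _.
have mX x k : x \in [:: x1; x2; x3] -> (0 < k)%N -> m (x ^+ k).
  case: k => // k xs _; rewrite exprSr; apply: ideal_setM => //.
  exact: ideal_gen_mem.
have [mX1 mX2 mX3] : [/\ forall k, (0 < k)%N -> m (x1 ^+ k),
    forall k, (0 < k)%N -> m (x2 ^+ k) & forall k, (0 < k)%N -> m (x3 ^+ k)].
  by split=> k; apply: mX; rewrite !inE eqxx ?orbT.
(* Expansion of the vanishing 3x3 determinant that repeats the row (x1^a1, x2^a2, x3^a3). *)
have relD : x1 ^+ a1 * D = - (x2 ^+ a2 * v1 + x3 ^+ a3 * v2).
  by rewrite /D /v1 /v2 !exprD; ring.
have idI : ideal_set [set` I] := ideal_gen_set _.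
have I1 : 1 \notin I.
  apply: contra x1N; apply: (ideal_gen_min idm) => y.
  rewrite !inE => /or3P[]/eqP->; apply: ideal_setB => //;
    rewrite ?exprD; apply: ideal_setM => //; by [apply: mX1|apply: mX2|apply: mX3].
have syz al be ga : al * v1 + be * v2 + ga * D = 0 -> [/\ m al, m be & m ga].
  rewrite -[RHS](mulr0 x1) => /(hn_syzygy a1_gt0 b1_gt0 reg2 reg3).
  have mx1 y : m (x1 * y) by rewrite mulrC; apply: ideal_setM => //; apply: (mX1 1%N).
  move=> [r [t [al' [be' [ga' [-> -> ->]]]]]].
  split; do ?[apply: (ideal_setD idm) | exact: mx1];
    apply: ideal_setM => //; by [apply: mX1|apply: mX2|apply: mX3].
(* Write x1 y in terms of v1, v2, D. The row parts of the coefficients are syzygies and drop out;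
   what remains is x1 times an element of I, and x1 cancels in A. *)
have x1_regI y : x1 * y \in I -> y \in I.
  move=> /ideal_gen3[al [be [ga /esym E]]].
  have [r [t [al' [be' [ga' [alE beE gaE]]]]]] :=
    hn_syzygy a1_gt0 b1_gt0 reg2 reg3 E.
  apply/ideal_gen3; exists al', be', ga'; apply/eqP; rewrite -subr_eq0; apply/eqP.
  apply: reg1; apply: (eq_by_sub (esym E)); rewrite alE beE gaE /v1 /v2 /D.
  by rewrite !exprD; ring.
have min_x1 P : minimal_prime I P -> x1 \notin P.
  move=> [IP minP]; apply/negP => x1P.
  have [|Q [IQ QP x1Q]] := @prime_below A [set` I] P x1 noethA idI.
    move=> t n tP; elim: n => [|n IHn].
      by rewrite mulr1 => /= /IP; rewrite (negPf tP).
    by rewrite exprS mulrCA => /x1_regI.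
  by case/negP: x1Q; apply: minP x1P.
have Iv : {subset ideal_gen [:: v1; v2] <= I}.
  move=> y /ideal_gen2[r [t ->]]; apply/ideal_gen3; exists r, t, 0.
  by rewrite mul0r addr0.
have vI : v1 \in I /\ v2 \in I.
  by split; apply: Iv; apply: ideal_gen_mem; rewrite !inE eqxx ?orbT.
have chain2 (P : prime_idealr A) : {subset I <= P} -> prime_chain P 2.
  case: s s2 sv s_reg => [|f [|g [|//]]] // _ sv s_reg IP.
  by apply: (regular_sequence2_chain noethA s_reg);
    apply: IP; apply: Iv; apply: sv; rewrite !inE eqxx ?orbT.
have min_height P : minimal_prime I P -> prime_height P 2.
  move=> minIP; have x1P := min_x1 P minIP; case: minIP => IP minP.
  split; first exact: chain2.
  apply: (@krull_height2 A P v1 v2) => //; [exact: IP vI.1|exact: IP vI.2|].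
  (* R misses x1, so [relD] forces D into R: P is minimal over (v1, v2) too. *)
  move=> R v1R v2R RP; apply: minP => //.
  apply: (ideal_gen_min (prime_ideal_set R)) => y.
  rewrite !inE => /or3P[]/eqP-> //.
  have : x1 ^+ a1 * D \in R.
    by rewrite relD rpredN; apply: rpredD; exact: idealMr.
  rewrite prime_idealrM => /orP[/prime_idealX/RP|//].
  by rewrite (negPf x1P).
split.
  exists 2%N; last by apply: (min_generators3 idm _ syz); exact/negP.
  split=> [|P IP]; last exact: chain2.
  have [|P minP] := minimal_prime_exists noethA _ I1; first exact: ideal_gen_ideal.
  by exists P; split; [exact: minP.1|exact: min_height].
move=> P minIP; have x1P := min_x1 P minIP; have [chP maxP] := min_height P minIP.
have [IP minP] := minIP.
have extI y : y \in I -> loc_map P y \in ideal_ext (@loc_map A P) I.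
  move=> yI; apply/asboolP; exists [:: y] => [z|].
    by rewrite inE => /eqP->.
  by apply: ideal_gen_mem; rewrite mem_head.
exists 2%N.
  have [R PR] := @loc_extend A P P (fun _ => id).
  split.
    exists R; split.
      move=> z /asboolP[t tI]; apply: (ideal_gen_min (prime_ideal_set R)) => w.
      by move=> /mapP[y /tI/IP yP ->]; apply/PR.
    by split=> [|k /(loc_prime_chain _ PR)]; [exact/(loc_prime_chain _ PR)|exact: maxP].
  (* By minimality of P, every prime over the extended ideal contracts to P. *)
  move=> T IT; have [Q QT QP] := loc_contract T.
  have PQ : {subset P <= Q} by apply: minP => // y /extI/IT/QT.
  apply/(@loc_prime_chain A P T) => // y.
  by split=> [/PQ/QT|/QT/QP].
exists [:: loc_map P v1; loc_map P v2]; split=> // z.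
have idz := ideal_gen_set [:: loc_map P v1; loc_map P v2].
apply/idP/idP.
  move=> /asboolP[t tI]; apply: (ideal_gen_min idz) => w /mapP[y /tI yI ->].
  apply: (loc_ideal_gen3 _ relD yI); apply: contra x1P; exact: prime_idealX.
move=> zv; apply/asboolP; exists [:: v1; v2] => // y.
by move=> /ideal_gen_mem/Iv.
Qed.
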